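(* Let $\beta=\frac{\|L''(\lambda_* )\|}{2}+\eta$ and $\gamma=\frac{\|T''(\lambda_* )\|}{2}+\eta$ be the constants defined in the context, let $\widehat x$ be the refined Ritz vector corresponding to the Ritz value $\mu$, and assume that $|\mu-\lambda_*|$ is small enough and satisfies $$\sigma_{\min}(L(\lambda_* ))-\|L'(\lambda_* )\||\mu-\lambda_*|-\beta|\mu-\lambda_*|^2>0.$$ Then $$\|T(\mu)\widehat x\|\leq\frac{\|T(\mu)x_*\|+\|T(\mu)\|\varepsilon}{\sqrt{1-\varepsilon^2}}\leq\frac{\|T(\mu)\|\varepsilon+\|T'(\lambda_* )\||\mu-\lambda_*|+\gamma|\mu-\lambda_*|^2}{\sqrt{1-\varepsilon^2}},$$ $$\sin\angle(x_*,\widehat x)\leq\frac{\|T(\mu)x_*\|+\|T(\mu)\|\varepsilon}{\sqrt{1-\varepsilon^2}\,\sigma_{\min}(L(\mu))}\leq\frac{\|T(\mu)\|\varepsilon+\|T'(\lambda_* )\||\mu-\lambda_*|+\gamma|\mu-\lambda_*|^2}{\sqrt{1-\varepsilon^2}\,\sigma_{\min}(L(\mu))},$$ with $\sigma_{\min}(L(\mu))\geq\sigma_{\min}(L(\lambda_* ))-\|L'(\lambda_* )\||\mu-\lambda_*|-\beta|\mu-\lambda_*|^2$.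
   Context: $\Omega\subseteq\mathbb{C}$ is a connected open set and $T:\Omega\to\mathbb{C}^{n\times n}$ is an analytic matrix-valued function that is regular, i.e. $\det T(\lambda)$ is not identically zero on $\Omega$. $(\lambda_*,x_* )$ is a simple eigenpair of $T$: $\lambda_*\in\Omega$ is a simple root of $\det T(\lambda)=0$, $T(\lambda_* )x_*=0$ and $\|x_*\|=1$. $\|\cdot\|$ is the 2-norm, $H$ denotes conjugate transpose, $\sigma_{\min}$ is the smallest singular value, and $\angle(\cdot,\cdot)$ is the acute angle between the lines spanned by two nonzero vectors. The columns of $X_\perp\in\mathbb{C}^{n\times(n-1)}$ form an orthonormal basis of the orthogonal complement of $\mathrm{span}\{x_*\}$, and $L(\lambda)=X_\perp^HT(\lambda)X_\perp$. $\mathcal{W}\subset\mathbb{C}^n$ is an $m$-dimensional subspace taken from a sequence of subspaces, $W\in\mathbb{C}^{n\times m}$ has orthonormal columns spanning $\mathcal{W}$, $B(\lambda)=W^HT(\lambda)W$, and $\varepsilon=\sin\angle(x_*,\mathcal{W})=\|(I-WW^H)x_*\|$, where it is assumed that $\varepsilon\to0$ as $\mathcal{W}$ changes (so $\varepsilon<1$). The Ritz value $\mu\in\Omega$ is an eigenvalue of $B$ ($\det B(\mu)=0$) selected to approximate $\lambda_*$. The refined Ritz vector $\widehat x\in\mathcal{W}$ is a unit-length vector satisfying $\|T(\mu)\widehat x\|=\min_{v\in\mathcal{W},\|v\|=1}\|T(\mu)v\|$. It is assumed that $\mu$ lies in a closed disc $\mathcal{D}=\{\mu\in\Omega:|\mu-\lambda_*|\leq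 r\}\subset\Omega$ on which the Taylor series of $T$ and $L$ at $\lambda_*$ converge. Here $\eta$ is an arbitrarily given (positive) constant and the radius $r$ is sufficiently small that, in the expansions $L(\mu)=L(\lambda_* )+L'(\lambda_* )(\mu-\lambda_* )+\bigl(\frac{L''(\lambda_* )}{2}+O(\mu-\lambda_* )\bigr)(\mu-\lambda_* )^2$ and $T(\mu)=T(\lambda_* )+T'(\lambda_* )(\mu-\lambda_* )+\bigl(\frac{T''(\lambda_* )}{2}+O(\mu-\lambda_* )\bigr)(\mu-\lambda_* )^2$, the $O(\mu-\lambda_* )$ terms have norm at most $\eta$ for all $\mu\in\mathcal{D}$. Thus the bracketed matrices have norms at most $\beta:=\frac{\|L''(\lambda_* )\|}{2}+\eta$ and $\gamma:=\frac{\|T''(\lambda_* )\|}{2}+\eta$, respectively, for all $\mu\in\mathcal{D}$. *)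

(* Defs.v *)
From HB Require Import structures.
From mathcomp Require Import all_boot all_order all_algebra.
From mathcomp Require Import all_classical all_reals all_analysis.
From mathcomp Require Import complex.

Set Implicit Arguments.
Unset Strict Implicit.
Unset Printing Implicit Defensive.

Import Order.TTheory GRing.Theory Num.Theory.
Import numFieldNormedType.Exports.

Local Open Scope classical_set_scope.
Local Open Scope ring_scope.
Local Open Scope sesquilinear_scope.

(* The analytic notions are stated over an arbitrary [K : numFieldType], whose
   topology is the one of MathComp-Analysis, and used at [K := R[i]]: the type
   [R[i]] itself carries no canonical topology, and the generic form avoids
   unfolding complex arithmetic during unification. *)
Section Analytic.
Variable K : numFieldType.

Definition connected_open (Omega : set K) := open Omega /\ connected Omega.

Definition analytic_on m n (Omega : set K) (T : K -> 'M[K]_(m, n)) :=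
  forall z0, Omega z0 ->
    exists a : nat -> 'M[K]_(m, n), exists2 rho : K, 0 < rho &
      forall z, `|z - z0| < rho ->
        series (fun k => (z - z0) ^+ k *: a k) @ \oo --> T z.

Definition simple_root (f : K -> K) (z : K) := f z = 0 /\ derive1 f z != 0.

Definition taylor_coef m n (T : K -> 'M[K]_(m, n)) (z0 : K) (k : nat) :
    'M[K]_(m, n) :=
  (k`!%:R)^-1 *: derive1n k T z0.

Definition taylor_cvg_on m n (T : K -> 'M[K]_(m, n)) (z0 : K) (D : set K) :=
  forall z, D z ->
    series (fun k => (z - z0) ^+ k *: taylor_coef T z0 k) @ \oo --> T z.

(* The "O(z - z0)" of the expansion
     T z = T z0 + (z - z0) T' z0 + (z - z0)^2 (T'' z0 / 2 + O(z - z0)),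
   that is, the sum of T^(k) z0 / k! (z - z0)^(k - 2) over k >= 3. *)
Definition taylor_rem2 m n (T : K -> 'M[K]_(m, n)) (z0 z : K) : 'M[K]_(m, n) :=
  limn (series (fun k => (z - z0) ^+ k.+1 *: taylor_coef T z0 k.+3)).

End Analytic.

Section Norms.
Variable R : realType.

Definition cabs (z : R[i]) : R := Normc.normc z.

Definition cdisc (z0 : R[i]) (r : R) : set R[i] := [set z | cabs (z - z0) <= r].

Definition norm2 n (x : 'cV[R[i]]_n) : R :=
  Num.sqrt (\sum_i cabs (x i 0) ^+ 2).

Definition opnorm2 m n (A : 'M[R[i]]_(m, n)) : R :=
  sup [set norm2 (A *m x) | x in [set x : 'cV[R[i]]_n | norm2 x <= 1]].

Definition singular_values n (A : 'M[R[i]]_n) : set R :=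
  [set s | 0 <= s /\ eigenvalue (A ^t* *m A) (s ^+ 2)%:C%C].

(* For [n = 0] there are no singular values and this is [0]. *)
Definition sigma_min n (A : 'M[R[i]]_n) : R := inf (singular_values A).

(* Acute angle between the lines spanned by the nonzero vectors x and y. *)
Definition line_angle n (x y : 'cV[R[i]]_n) : R :=
  acos (cabs ((x ^t* *m y) 0 0) / (norm2 x * norm2 y)).

Definition orthonormal_cols m n (W : 'M[R[i]]_(n, m)) := W ^t* *m W = 1%:M.

Definition colspan m n (W : 'M[R[i]]_(n, m)) : set 'cV[R[i]]_n :=
  range (fun y : 'cV[R[i]]_m => W *m y).

Definition orthonormal_basis_orthogonal n (X : 'M[R[i]]_(n, n.-1))
    (x : 'cV[R[i]]_n) :=
  orthonormal_cols X /\ colspan X = [set v | x ^t* *m v = 0].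

(* Sine of the angle between the unit vector x and the column span of W, for
   W with orthonormal columns. *)
Definition sin_angle_colspan m n (x : 'cV[R[i]]_n) (W : 'M[R[i]]_(n, m)) : R :=
  norm2 ((1%:M - W *m W ^t*) *m x).

Definition simple_eigenpair n (T : R[i] -> 'M[R[i]]_n) (lam : R[i])
    (x : 'cV[R[i]]_n) :=
  [/\ simple_root (fun z => \det (T z)) lam, T lam *m x = 0 & norm2 x = 1].

Definition compression m n (X : 'M[R[i]]_(n, m)) (T : R[i] -> 'M[R[i]]_n)
    (z : R[i]) : 'M[R[i]]_m :=
  X ^t* *m T z *m X.

Definition refined_ritz_vector m n (A : 'M[R[i]]_n) (W : 'M[R[i]]_(n, m))
    (xhat : 'cV[R[i]]_n) :=
  [/\ colspan W xhat, norm2 xhat = 1 &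
    forall v, colspan W v -> norm2 v = 1 ->
      norm2 (A *m xhat) <= norm2 (A *m v)].

End Norms.

(* Main.v *)
Require Import Defs.
From HB Require Import structures.
From mathcomp Require Import all_boot all_order all_algebra.
From mathcomp Require Import all_classical all_reals all_analysis.
From mathcomp Require Import complex.
From mathcomp Require Import ring lra.
Set Implicit Arguments.
Unset Strict Implicit.
Unset Printing Implicit Defensive.

Import Order.TTheory GRing.Theory Num.Theory.
Import numFieldNormedType.Exports.
Local Open Scope classical_set_scope.
Local Open Scope ring_scope.

(* Multiplying [T(mu) xhat] by [X_perp^H] does not give the sine bound, since
   [X_perp^H T(mu) x] need not vanish.  Instead split [xhat = Y + w] with [Y]
   along the projection [P x] of [x] onto the search space and [w] orthogonal to
   [P x], hence to [x].  Minimality of [|T(mu) xhat|] gives two stationarity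
   equations linking [|T(mu) Y|^2], [|T(mu) w|^2] and the cross term
   [Re <T(mu) Y, T(mu) w>].  On the orthogonal complement of [x] the map [T(mu)]
   is bounded below by [sigma_min(L(mu))].  This bounds [|T(mu) w|] from below
   and also controls the cross term, because the component of [Y] orthogonal to
   [x] is orthogonal to [w] as well.  What remains is a polynomial inequality in
   [|Y|^2], [|w|^2] and [eps^2]. *)

(** * Scalar inequalities behind the sine bound *)

(** Here [S] is eps^2, while [X] and [Y] are the squared norms of the parts of xhat along [P x] and
    orthogonal to it. The rest is scaled by sigma^2: [P] and [d] are the squared images of these
    parts, [- H] their cross term, [t] the squared residual, [q] the squared target bound.
    Eliminating [t] from the two equations leaves [(X - Y) * H], which is bounded below and
    confronted with the upper bound on [H ^+ 2]. *)
Lemma stationary_split_le (R : realFieldType) (S X Y q d P H t : R) :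
  0 <= S -> 0 <= X -> 0 <= Y -> X + Y = 1 -> S <= q -> q < 1 - S ->
  Y <= d -> 0 <= P -> P <= X * q -> H ^+ 2 <= X * d * (q - S) ->
  d - H = t * Y -> P - H = t * X -> t <= q ->
  X * Y * ((1 - q) ^+ 2 + 4 * (q - S)) <= q - S /\ Y <= X.
Proof.
move=> S0 X0 Y0 XY Sq q1 Yd P0 PX Hd e1 e2 tq.
have [->|Yn0] := eqVneq Y 0; first by rewrite mulr0 mul0r; split=> //; lra.
have Yp : 0 < Y by rewrite lt_neqAle eq_sym Yn0.
have dp : 0 < d by apply: lt_le_trans Yd.
have e3 : X * d - Y * P = (X - Y) * H.
  have -> : d = H + t * Y by lra.
  have -> : P = H + t * X by lra.
  ring.
have q0 : 0 < 1 - q by lra.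
have lo : X * d * (1 - q) <= (X - Y) * H.
  rewrite -e3.
  have : Y * P <= Y * (X * q) by rewrite ler_pM2l.
  have : (X * q) * Y <= (X * q) * d by rewrite ler_wpM2l // mulr_ge0 //; lra.
  have -> : X * d * (1 - q) = X * d - X * q * d by ring.
  by rewrite (mulrC Y (X * q)); lra.
(* If [X < Y], then [lo] forces [H <= 0], so [t * Y = d - H >= Y], against [t <= q < 1]. *)
have YX : Y <= X.
  rewrite leNgt; apply/negP=> XltY.
  have H0 : H <= 0.
    have : 0 <= X * d * (1 - q) by rewrite !mulr_ge0 //; lra.
    have : 0 < Y - X by lra.
    by move=> a b; rewrite -(ler_pM2l a) mulr0; have := le_trans b lo; lra.
  have : t * Y <= q * Y by rewrite ler_pM2r.
  have : q * Y < Y by rewrite -{2}(mul1r Y) ltr_pM2r //; lra.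
  by lra.
split=> //.
have Xp : 0 < X by lra.
have Xd : 0 < X * d by rewrite mulr_gt0.
(* Square [lo], insert the bound on [H ^+ 2], and cancel one factor [X * d]. *)
have sq : (X * d * (1 - q)) ^+ 2 <= (X - Y) ^+ 2 * H ^+ 2.
  rewrite -exprMn lerXn2r ?nnegrE //; first by rewrite !mulr_ge0 //; lra.
  by apply: le_trans lo; rewrite !mulr_ge0 //; lra.
have : (X * d * (1 - q)) ^+ 2 <= (X - Y) ^+ 2 * (X * d * (q - S)).
  by apply: le_trans sq _; rewrite ler_wpM2l // sqr_ge0.
have -> : (X * d * (1 - q)) ^+ 2 = X * d * (X * d * (1 - q) ^+ 2) by ring.
have -> : (X - Y) ^+ 2 * (X * d * (q - S)) =
  X * d * ((X - Y) ^+ 2 * (q - S)) by ring.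
rewrite ler_pM2l //.
have -> : (X - Y) ^+ 2 = 1 - 4 * (X * Y).
  have -> : Y = 1 - X by lra.
  ring.
have : X * Y * (1 - q) ^+ 2 <= X * d * (1 - q) ^+ 2.
  by rewrite ler_wpM2r ?sqr_ge0 // ler_pM2l.
by lra.
Qed.

(** For [q >= 1 - S] it is enough that [S + (1 - S) * Y <= 1]. Otherwise the failure of the
    conclusion reads [y < e * Y] in the variables below, and the previous lemma turns this into a
    cubic inequality in [u] that contradicts [2 * u <= e]. *)
Lemma ritz_sine_ineq (R : realFieldType) (S X Y q d P H t : R) :
  0 <= S -> S < 1 -> 0 <= X -> 0 <= Y -> X + Y = 1 -> S <= q ->
  Y <= d -> 0 <= P -> P <= X * q -> H ^+ 2 <= X * d * (q - S) ->
  d - H = t * Y -> P - H = t * X -> t <= q ->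
  (S + (1 - S) * Y) * (1 - S) <= q.
Proof.
move=> S0 S1 X0 Y0 XY Sq Yd P0 PX Hd e1 e2 tq.
have [q1|q1] := leP (1 - S) q.
  apply: le_trans q1; rewrite -{3}(mul1r (1 - S)) ler_wpM2r //; first by lra.
  suff : (1 - S) * Y <= 1 - S by lra.
  by rewrite -{2}(mulr1 (1 - S)) ler_wpM2l //; lra.
have [gap YX] :=
  stationary_split_le S0 X0 Y0 XY Sq q1 Yd P0 PX Hd e1 e2 tq.
rewrite leNgt; apply/negP=> big.
pose u := q - S; pose e := (1 - S) ^+ 2; pose y := u + S ^+ 2.
have u0 : 0 <= u by rewrite /u; lra.
have ep : 0 < e by rewrite exprn_gt0 //; lra.
have uy : u <= y by rewrite /y lerDl sqr_ge0.
have yY : y < e * Y.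
  suff : (S + (1 - S) * Y) * (1 - S) = S * (1 - S) + e * Y.
    by move=> E; move: big; rewrite E /y /u expr2; lra.
  by rewrite /e; ring.
have Y2 : Y <= 2^-1 by lra.
have eY2 : e * Y <= e * 2^-1 by rewrite ler_pM2l.
(* The map [z * (e - z)] increases up to [e / 2], and [u <= y < e * Y <= e / 2]. *)
have k1 : y * (e - y) < e * Y * (e - e * Y).
  have : 0 < (e * Y - y) * (e - e * Y - y) by rewrite mulr_gt0 //; lra.
  by lra.
have k2 : u * (e - u) <= y * (e - y).
  have : 0 <= (y - u) * (e - y - u) by rewrite mulr_ge0 //; lra.
  by lra.
have k3 : u * (e - u) < e ^+ 2 * (X * Y).
  apply: le_lt_trans k2 _; apply: lt_le_trans k1 _.
  have -> : X = 1 - Y by lra.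
  by rewrite le_eqVlt; apply/orP; left; apply/eqP; ring.
have b : e + 2 * u <= (1 - q) ^+ 2 + 4 * (q - S).
  have -> : (1 - q) ^+ 2 + 4 * (q - S) = e + 2 * u + (2 * u * S + u ^+ 2).
    by rewrite /e /u; ring.
  by rewrite lerDl addr_ge0 ?sqr_ge0 // !mulr_ge0.
have eu : 0 < e + 2 * u by lra.
have k4 : u * (e - u) * (e + 2 * u) < e ^+ 2 * u.
  apply: (@lt_le_trans _ _ (e ^+ 2 * (X * Y) * (e + 2 * u))).
    by rewrite ltr_pM2r.
  rewrite -mulrA ler_pM2l; last by rewrite exprn_gt0.
  apply: le_trans gap; rewrite ler_wpM2l //; exact: mulr_ge0.
have E : u * (e - u) * (e + 2 * u) = e ^+ 2 * u + u ^+ 2 * (e - 2 * u) by ring.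
move: k4; rewrite E gtrDl ltNge => /negP; apply.
by rewrite mulr_ge0 ?sqr_ge0 //; lra.
Qed.

Lemma discriminant_le (R : realFieldType) (a b c : R) :
  0 <= c -> (forall t, 0 <= a + 2 * t * b + t ^+ 2 * c) -> b ^+ 2 <= a * c.
Proof.
move=> c0 pos.
have [c_eq0|cn0] := eqVneq c 0.
  have [->|bn0] := eqVneq b 0; first by rewrite c_eq0 mulr0 expr0n.
  (* With [c = 0] the polynomial is affine; this [t] gives it the value -1. *)
  have := pos (- (a + 1) / (2 * b)).
  rewrite c_eq0 mulr0 addr0.
  have -> : a + 2 * (- (a + 1) / (2 * b)) * b = - 1 by field.
  by rewrite oppr_ge0 ler10.
have cp : 0 < c by rewrite lt_neqAle eq_sym cn0.
have := pos (- b / c).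
have -> : a + 2 * (- b / c) * b + (- b / c) ^+ 2 * c = (a * c - b ^+ 2) / c.
  by field.
by rewrite pmulr_lge0 ?invr_gt0 // subr_ge0.
Qed.

(** The sign of [c] is unknown; raising it to [Num.max c 0] preserves the hypothesis and makes the
    discriminant bound applicable with constant term 0. *)
Lemma linear_coef0 (R : realFieldType) (b c : R) :
  (forall t, 0 <= 2 * t * b + t ^+ 2 * c) -> b = 0.
Proof.
move=> pos.
have pos' t : 0 <= 0 + 2 * t * b + t ^+ 2 * Num.max c 0.
  rewrite add0r; apply: le_trans (pos t) _.
  by rewrite lerD2l ler_wpM2l ?sqr_ge0 // le_max lexx.
have c0 : 0 <= Num.max c 0 by rewrite le_max lexx orbT.
have := discriminant_le c0 pos'.
by rewrite mul0r le_eqVlt ltNge sqr_ge0 orbF sqrf_eq0 => /eqP.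
Qed.

(** * The Euclidean inner product of C^n seen as a real space *)

Section RealInnerProduct.
Local Open Scope sesquilinear_scope.
Variable R : realType.
Local Notation C := R[i].

(** Taking the real part makes squared norms along [u + t v], [t] real, into real quadratic
    polynomials, to which the discriminant lemmas apply. *)
Definition rdot n (u v : 'cV[C]_n) : R := complex.Re ((u ^t* *m v) 0 0).

Lemma cabsE (z : C) : `|z| = (cabs z)%:C%C.
Proof. by []. Qed.

Lemma cabs_sqr (z : C) : cabs z ^+ 2 = complex.Re z ^+ 2 + complex.Im z ^+ 2.
Proof.
by case: z => a b; rewrite /cabs /= sqr_sqrtr // addr_ge0 ?sqr_ge0.
Qed.

Lemma cabs_ge0 (z : C) : 0 <= cabs z.
Proof. by case: z => a b; rewrite /cabs /= sqrtr_ge0. Qed.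

Lemma cabs_real (t : R) : cabs t%:C%C = `|t|.
Proof. by rewrite /cabs /= expr0n addr0 sqrtr_sqr. Qed.

Lemma Re_conjM (z w : C) :
  complex.Re (z^* * w) = complex.Re z * complex.Re w + complex.Im z * complex.Im w.
Proof. by case: z => a b; case: w => c d /=; rewrite mulNr opprK. Qed.

Lemma ReD (z w : C) : complex.Re (z + w) = complex.Re z + complex.Re w.
Proof. by case: z; case: w. Qed.

Lemma rdotE n (u v : 'cV[C]_n) :
  rdot u v = \sum_i (complex.Re (u i 0) * complex.Re (v i 0)
                     + complex.Im (u i 0) * complex.Im (v i 0)).
Proof.
rewrite /rdot mxE (big_morph _ ReD (erefl : complex.Re (0 : C) = 0)).
by apply: eq_bigr => i _; rewrite !mxE; exact: Re_conjM.
Qed.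

Lemma rdotC n (u v : 'cV[C]_n) : rdot u v = rdot v u.
Proof.
by rewrite !rdotE; apply: eq_bigr => i _; congr (_ + _); rewrite mulrC.
Qed.

Lemma rdotDr n (u v w : 'cV[C]_n) : rdot u (v + w) = rdot u v + rdot u w.
Proof. by rewrite /rdot mulmxDr mxE ReD. Qed.

Lemma rdotNr n (u v : 'cV[C]_n) : rdot u (- v) = - rdot u v.
Proof. by rewrite /rdot mulmxN mxE; case: (_ 0 0). Qed.

Lemma rdotZr n (t : R) (u v : 'cV[C]_n) :
  rdot u (t%:C%C *: v) = t * rdot u v.
Proof.
rewrite /rdot -scalemxAr mxE; case: (_ 0 0) => a b /=.
by rewrite mul0r subr0.
Qed.

Lemma rdotDl n (u v w : 'cV[C]_n) : rdot (u + v) w = rdot u w + rdot v w.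
Proof. by rewrite rdotC rdotDr !(rdotC w). Qed.

Lemma rdotNl n (u v : 'cV[C]_n) : rdot (- u) v = - rdot u v.
Proof. by rewrite rdotC rdotNr rdotC. Qed.

Lemma rdotZl n (t : R) (u v : 'cV[C]_n) :
  rdot (t%:C%C *: u) v = t * rdot u v.
Proof. by rewrite rdotC rdotZr rdotC. Qed.

Lemma rdot_adj m n (A : 'M[C]_(m, n)) u v :
  rdot u (A *m v) = rdot (A ^t* *m u) v.
Proof. by rewrite /rdot trmx_mul map_mxM trmxCK mulmxA. Qed.

Lemma norm2_sqr n (u : 'cV[C]_n) : norm2 u ^+ 2 = rdot u u.
Proof.
rewrite /norm2 sqr_sqrtr; last by apply: sumr_ge0 => i _; exact: sqr_ge0.
by rewrite rdotE; apply: eq_bigr => i _; rewrite cabs_sqr !expr2.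
Qed.

Lemma norm2_ge0 n (u : 'cV[C]_n) : 0 <= norm2 u.
Proof. exact: sqrtr_ge0. Qed.

Lemma norm2Z n (k : C) (u : 'cV[C]_n) : norm2 (k *: u) = cabs k * norm2 u.
Proof.
rewrite /norm2 -(ger0_norm (cabs_ge0 k)) -sqrtr_sqr -sqrtrM ?sqr_ge0 //.
congr Num.sqrt; rewrite mulr_sumr; apply: eq_bigr => i _.
by rewrite mxE /cabs Normc.normcM exprMn.
Qed.

Lemma norm2N n (u : 'cV[C]_n) : norm2 (- u) = norm2 u.
Proof.
rewrite -scaleN1r norm2Z.
have -> : (-1 : C) = (-1)%:C%C by rewrite rmorphN.
by rewrite cabs_real normrN1 mul1r.
Qed.

Lemma norm2_0 n : norm2 (0 : 'cV[C]_n) = 0.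
Proof. by rewrite -(scale0r 0) norm2Z (cabs_real 0) normr0 mul0r. Qed.

Lemma norm2_eq0 n (u : 'cV[C]_n) : norm2 u = 0 -> u = 0.
Proof.
move=> /eqP; rewrite -sqrf_eq0 norm2_sqr rdotE psumr_eq0; last first.
  by move=> i _; rewrite addr_ge0 // -expr2 sqr_ge0.
move=> /allP u0; apply/matrixP => i j; rewrite ord1 mxE.
have := u0 i (mem_index_enum i); rewrite -!expr2 paddr_eq0 ?sqr_ge0 //.
by case: (u i 0) => a b /=; rewrite !sqrf_eq0 => /andP[/eqP-> /eqP->].
Qed.

Lemma norm2_sqrDZ n (t : R) (u v : 'cV[C]_n) :
  norm2 (u + t%:C%C *: v) ^+ 2
  = norm2 u ^+ 2 + 2 * t * rdot u v + t ^+ 2 * norm2 v ^+ 2.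
Proof.
rewrite !norm2_sqr rdotDl !rdotDr !rdotZl !rdotZr (rdotC v u); ring.
Qed.

Lemma norm2_sqrD n (u v : 'cV[C]_n) :
  norm2 (u + v) ^+ 2 = norm2 u ^+ 2 + 2 * rdot u v + norm2 v ^+ 2.
Proof. rewrite !norm2_sqr rdotDl !rdotDr (rdotC v u); ring. Qed.

(** Cauchy-Schwarz, from the discriminant of [norm2 (u + t v) ^+ 2]. *)
Lemma rdot_le n (u v : 'cV[C]_n) : rdot u v <= norm2 u * norm2 v.
Proof.
have sq : rdot u v ^+ 2 <= (norm2 u * norm2 v) ^+ 2.
  rewrite exprMn; apply: discriminant_le; first exact: sqr_ge0.
  by move=> t; rewrite -norm2_sqrDZ sqr_ge0.
apply: le_trans (ler_norm _) _.
by rewrite -(@ler_pXn2r _ 2) ?nnegrE ?mulr_ge0 ?norm2_ge0 // real_normK ?num_real.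
Qed.

Lemma norm2D n (u v : 'cV[C]_n) : norm2 (u + v) <= norm2 u + norm2 v.
Proof.
rewrite -(@ler_pXn2r _ 2) ?nnegrE ?addr_ge0 ?norm2_ge0 // norm2_sqrD.
by have := rdot_le u v; rewrite sqrrD; lra.
Qed.

End RealInnerProduct.

(** * Operator norm and smallest singular value *)

Section SingularValues.
Local Open Scope sesquilinear_scope.
Variable R : realType.
Local Notation C := R[i].

Lemma norm2_sum n (I : finType) (F : I -> 'cV[C]_n) :
  norm2 (\sum_i F i) <= \sum_i norm2 (F i).
Proof.
apply: (big_ind2 (fun u t => norm2 u <= t)) => //; first by rewrite norm2_0.
by move=> u s v t us vt; apply: le_trans (norm2D _ _) _; apply: lerD.
Qed.

Lemma cabs_le_norm2 n (x : 'cV[C]_n) j : cabs (x j 0) <= norm2 x.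
Proof.
rewrite -(ger0_norm (cabs_ge0 (x j 0))) -sqrtr_sqr ler_wsqrtr //.
by rewrite (bigD1 j) //= lerDl sumr_ge0 // => i _; exact: sqr_ge0.
Qed.

(** A crude bound, meant to show that the set under the [sup] of [opnorm2] is bounded. *)
Lemma norm2_mulmx_le_sum m n (A : 'M[C]_(m, n)) x :
  norm2 x <= 1 -> norm2 (A *m x) <= \sum_j norm2 (col j A).
Proof.
move=> x1; have -> : A *m x = \sum_j x j 0 *: col j A.
  apply/matrixP=> i k; rewrite ord1 !mxE summxE; apply: eq_bigr => j _.
  by rewrite !mxE mulrC.
apply: le_trans (norm2_sum _) _; apply: ler_sum => j _.
rewrite norm2Z ler_piMl ?norm2_ge0 //.
exact: le_trans (cabs_le_norm2 _ _) x1.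
Qed.

Lemma opnorm2_has_sup m n (A : 'M[C]_(m, n)) :
  has_sup [set norm2 (A *m x) | x in [set x : 'cV[C]_n | norm2 x <= 1]].
Proof.
split; first by exists (norm2 (A *m 0)), 0 => //=; rewrite norm2_0.
exists (\sum_j norm2 (col j A)) => _ [x x1 <-].
exact: norm2_mulmx_le_sum.
Qed.

Lemma norm2_mulmx_le m n (A : 'M[C]_(m, n)) x :
  norm2 (A *m x) <= opnorm2 A * norm2 x.
Proof.
have [x0|xn0] := eqVneq (norm2 x) 0.
  by rewrite (norm2_eq0 x0) mulmx0 !norm2_0 mulr0.
have xp : 0 < norm2 x by rewrite lt_neqAle eq_sym xn0 norm2_ge0.
rewrite -ler_pdivrMr // mulrC.
have := cabs_real (norm2 x)^-1; rewrite gtr0_norm ?invr_gt0 // => {1}<-.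
rewrite -norm2Z scalemxAr; apply: ub_le_sup; first by case: (opnorm2_has_sup A).
exists ((norm2 x)^-1%:C%C *: x) => //=.
by rewrite norm2Z cabs_real gtr0_norm ?invr_gt0 // mulVf.
Qed.

Lemma opnorm2_ge0 m n (A : 'M[C]_(m, n)) : 0 <= opnorm2 A.
Proof.
apply: ub_le_sup; first by case: (opnorm2_has_sup A).
by exists 0; rewrite /= ?mulmx0 norm2_0.
Qed.

Lemma dotmx_self n (u : 'cV[C]_n) : (u ^t* *m u) 0 0 = (norm2 u ^+ 2)%:C%C.
Proof.
rewrite /norm2 sqr_sqrtr; last by apply: sumr_ge0 => i _; exact: sqr_ge0.
rewrite mxE rmorph_sum; apply: eq_bigr => i _.
by rewrite !mxE mulrC -normCK cabsE -rmorphXn.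
Qed.

Lemma singular_values_ge0 n (A : 'M[C]_n) : lbound (singular_values A) 0.
Proof. by move=> s []. Qed.

Lemma sigma_min_ge0 n (A : 'M[C]_n) : 0 <= sigma_min A.
Proof.
have [ne|/set0P/negP] := pselect (singular_values A !=set0).
  exact: lb_le_inf ne (@singular_values_ge0 _ A).
by rewrite negbK => /eqP E; rewrite /sigma_min E inf0.
Qed.

Lemma gram_hermitian m n (A : 'M[C]_(m, n)) :
  (A ^t* *m A) ^t* = A ^t* *m A.
Proof. by rewrite trmx_mul map_mxM trmxCK. Qed.

(** Unitary diagonalization of the Hermitian matrix [A^H A], with the eigenvalues displayed as
    squares of singular values. *)
Lemma gram_spectral n (A : 'M[C]_n) :
  exists (P : 'M[C]_n) (s : 'I_n -> R),
    [/\ P ^t* *m P = 1%:M, P *m (A ^t* *m A) = diag_mx (\row_i (s i ^+ 2)%:C%C) *m P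
      & forall i, singular_values A (s i)].
Proof.
set M := A ^t* *m A.
have nM : M \is normalmx by apply/normalmxP; rewrite gram_hermitian.
have uP := spectral_unitarymx M; set P := spectralmx M in uP.
have PP : P *m P ^t* = 1%:M by apply/unitarymxP.
have PM : P *m M = diag_mx (spectral_diag M) *m P.
  have /orthomx_spectralP E := nM; rewrite {1}E -/P -!mulmxA mulKVmx //.
  exact: spectral_unit.
(* For a unit eigenvector p of [A^H A] the eigenvalue is [|A p|^2], so [|A p|] is its nonnegative
   root. *)
pose s i := norm2 (A *m (row i P) ^t*).
have rowM i : row i P *m M = spectral_diag M 0 i *: row i P.
  by rewrite -row_mul PM mul_diag_mx; apply/matrixP => k j; rewrite !mxE.
have row1 i : (row i P *m (row i P) ^t*) 0 0 = 1.
  transitivity ((P *m P ^t*) i i); last by rewrite PP mxE eqxx.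
  by rewrite !mxE; apply: eq_bigr => j _; rewrite !mxE.
have sE i : spectral_diag M 0 i = (s i ^+ 2)%:C%C.
  rewrite -dotmx_self trmx_mul map_mxM trmxCK mulmxA -(mulmxA (row i P)) -/M.
  by rewrite rowM -scalemxAl mxE row1 mulr1.
exists P, s; split.
- by apply/mulmx1C.
- rewrite PM; congr (diag_mx _ *m _).
  by apply/matrixP => k i; rewrite ord1 mxE -sE.
- move=> i; split; first exact: norm2_ge0.
  rewrite -/M -sE; apply/eigenvalueP; exists (row i P); first exact: rowM.
  apply/eqP => r0; have := row1 i; rewrite r0 mul0mx mxE => /esym/eqP.
  by rewrite oner_eq0.
Qed.

(** In the eigenbasis, [|A v|^2] is the sum of [s i ^+ 2 * |(P v)_i|^2], and each [s i] is at least
    [sigma_min A]. *)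
Lemma sigma_min_norm2 n (A : 'M[C]_n) v :
  sigma_min A * norm2 v <= norm2 (A *m v).
Proof.
have [P [s [PP PM sP]]] := gram_spectral A.
rewrite -(@ler_pXn2r _ 2) ?nnegrE ?mulr_ge0 ?sigma_min_ge0 ?norm2_ge0 //.
rewrite exprMn !norm2_sqr.
have normP u : rdot v u = rdot (P *m v) (P *m u).
  by rewrite rdot_adj mulmxA PP mul1mx.
rewrite rdot_adj rdotC mulmxA normP (normP (_ *m v)) mulmxA PM -mulmxA.
rewrite !rdotE mulr_sumr; apply: ler_sum => i _.
have -> : (diag_mx (\row_i (s i ^+ 2)%:C%C) *m (P *m v)) i 0
    = (s i ^+ 2)%:C%C * (P *m v) i 0 by rewrite mul_diag_mx mxE mxE.
have sAs : sigma_min A ^+ 2 <= s i ^+ 2.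
  have [s0 _] := sP i.
  rewrite ler_pXn2r ?nnegrE ?sigma_min_ge0 //.
  apply: ge_inf; last exact: sP.
  by exists 0; exact: singular_values_ge0.
case: ((P *m v) i 0) => a b /=; rewrite !mul0r subr0 addr0.
have -> : a * (s i ^+ 2 * a) + b * (s i ^+ 2 * b) = s i ^+ 2 * (a * a + b * b).
  by ring.
by rewrite ler_wpM2r // addr_ge0 // -expr2 sqr_ge0.
Qed.

(** A singular value [s] is attained as [|A u| / |u|] at an eigenvector. For [n = 0] the infimum is
    over the empty set and is 0, hence the condition on [n]. *)
Lemma le_sigma_min n (A : 'M[C]_n) c : (0 < n)%N ->
  (forall v, c * norm2 v <= norm2 (A *m v)) -> c <= sigma_min A.
Proof.
move=> n_gt0 cA; apply: lb_le_inf.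
  have [P [s [_ _ sP]]] := gram_spectral A.
  by exists (s (Ordinal n_gt0)); exact: sP.
(* [eigenvalue] supplies a row eigenvector [w]; the column vector needed is its conjugate
   transpose. *)
move=> s [s0 /eigenvalueP[w wE wn0]].
have un0 : norm2 (w ^t*) != 0.
  apply/eqP => /norm2_eq0 u0; move/eqP: wn0; apply.
  by rewrite -(trmxCK w) u0 trmx0 map_mx0.
have up : 0 < norm2 (w ^t*) by rewrite lt_neqAle eq_sym un0 norm2_ge0.
have sE : norm2 (A *m w ^t*) = s * norm2 (w ^t*).
  apply/eqP; rewrite -(@eqrXn2 _ 2) ?norm2_ge0 ?mulr_ge0 ?norm2_ge0 //.
  apply/eqP; apply: (@complexI R).
  rewrite -dotmx_self exprMn rmorphM /= -dotmx_self.
  by rewrite trmx_mul map_mxM trmxCK mulmxA -(mulmxA w) wE -scalemxAl mxE.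
by rewrite -(ler_pM2r up) -sE.
Qed.

End SingularValues.

(** * Second-order Taylor expansion and its norm bound *)

Section Taylor.
Variable K : numFieldType.
Variables m n : nat.

Lemma taylor_order2 (T : K -> 'M[K]_(m, n)) (z0 z : K) (D : set K) :
  taylor_cvg_on T z0 D -> D z ->
  T z = T z0 + (z - z0) *: derive1 T z0
        + (z - z0) ^+ 2 *: (2^-1 *: derive1n 2 T z0 + taylor_rem2 T z0 z).
Proof.
move=> TD Dz.
(* At [z0] the remainder is multiplied by 0; elsewhere [z - z0] can be inverted. *)
have [->|zz0] := eqVneq z z0.
  by rewrite subrr expr0n /= !scale0r !addr0.
have h0 : z - z0 != 0 by rewrite subr_eq0.
set h := z - z0 in h0 *.
have := TD _ Dz; rewrite -/h; set u := (fun k => _) => uT.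
pose q := u 0%N + u 1%N + u 2%N.
(* The first [N] terms of the remainder are the Taylor terms of index 3 to [N + 2] divided by
   [h ^+ 2]; [q] holds those of index 0, 1 and 2. *)
have wE : series (fun k => h ^+ k.+1 *: taylor_coef T z0 k.+3)
    = (fun N => h ^- 2 *: (series u (N + 3)%N - q)).
  apply/funext => N; elim: N => [|N IH].
    rewrite /series /= big_geq // !big_nat_recr //= big_geq // add0r.
    by rewrite subrr scaler0.
  rewrite seriesSr IH addSn seriesSr [in RHS]addrAC [in RHS]scalerDr; congr (_ + _).
  rewrite /u addn3; move: (taylor_coef _ _ _) => c; rewrite scalerA.
  have -> : h ^+ N.+3 = h ^+ 2 * h ^+ N.+1 by rewrite -exprD.
  by rewrite mulKf // expf_neq0.
have remE : taylor_rem2 T z0 z = h ^- 2 *: (T z - q).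
  rewrite /taylor_rem2 -/h wE; apply: cvg_lim => //.
  apply: cvgZr; apply: cvgB; last exact: cvg_cst.
  by rewrite cvg_shiftn.
rewrite remE scalerDr !scalerA mulfV ?expf_neq0 // scale1r /q /u /taylor_coef.
rewrite expr0 expr1 !scale1r !derive1n0 derive1n1 invr1 !scale1r !scalerA.
by rewrite addrA [RHS]addrC subrK.
Qed.

End Taylor.

(** Used twice: for [L] it controls the change of [sigma_min], for [T] it bounds [T mu *m x]. *)
Lemma norm2_taylor_le (R : realType) m n (T : R[i] -> 'M[R[i]]_(m, n))
    (z0 z : R[i]) (D : set R[i]) (eta : R) v :
  taylor_cvg_on T z0 D -> D z -> opnorm2 (taylor_rem2 T z0 z) <= eta ->
  norm2 ((T z - T z0) *m v) <=
    (opnorm2 (derive1 T z0) * cabs (z - z0)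
     + (opnorm2 (derive1n 2 T z0) / 2 + eta) * cabs (z - z0) ^+ 2) * norm2 v.
Proof.
move=> TD Dz rem_eta; rewrite (taylor_order2 TD Dz) -(addrA (T z0)) (addrC (T z0)) addrK.
rewrite mulmxDl -!scalemxAl mulmxDl -scalemxAl.
apply: le_trans (norm2D _ _) _; rewrite mulrDl !norm2Z.
have c2 : cabs (2^-1 : R[i]) = 2^-1.
  have -> : (2^-1 : R[i]) = (2^-1)%:C%C by rewrite fmorphV rmorph_nat.
  by rewrite cabs_real ger0_norm.
apply: lerD.
  by rewrite mulrAC [leRHS]mulrC ler_wpM2l ?cabs_ge0 // norm2_mulmx_le.
have -> : cabs ((z - z0) ^+ 2) = cabs (z - z0) ^+ 2.
  by rewrite !expr2 /cabs Normc.normcM.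
rewrite [leRHS]mulrAC [leRHS]mulrC.
rewrite ler_wpM2l ?exprn_ge0 ?cabs_ge0 //.
apply: le_trans (norm2D _ _) _; rewrite mulrDl norm2Z c2; apply: lerD.
  by rewrite mulrAC mulrC ler_wpM2r ?invr_ge0 // norm2_mulmx_le.
apply: le_trans (norm2_mulmx_le _ _) _.
by rewrite ler_wpM2r ?norm2_ge0.
Qed.

(** * Orthonormal columns, compression, and optimality of the refined Ritz vector *)

Section RefinedRitzVector.
Local Open Scope sesquilinear_scope.
Variable R : realType.
Local Notation C := R[i].

Lemma orthonormal_cols_norm2 m n (W : 'M[C]_(n, m)) y :
  orthonormal_cols W -> norm2 (W *m y) = norm2 y.
Proof.
move=> WW; apply/eqP; rewrite -(@eqrXn2 _ 2) ?norm2_ge0 //; apply/eqP.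
by rewrite !norm2_sqr rdot_adj mulmxA WW mul1mx.
Qed.

(** [|W^H u|^2 = <W W^H u, u>], to which Cauchy-Schwarz and the isometry of [W] apply. *)
Lemma orthonormal_cols_adj_norm2 m n (W : 'M[C]_(n, m)) u :
  orthonormal_cols W -> norm2 (W ^t* *m u) <= norm2 u.
Proof.
move=> WW; have [->|p0] := eqVneq (norm2 (W ^t* *m u)) 0.
  exact: norm2_ge0.
have p : 0 < norm2 (W ^t* *m u) by rewrite lt_neqAle eq_sym p0 norm2_ge0.
rewrite -(ler_pM2r p) -expr2 norm2_sqr -rdot_adj.
by rewrite -(orthonormal_cols_norm2 (W ^t* *m u) WW) rdot_le.
Qed.

(** Write [w = X y]. Applying [X^H] to [A w] cannot increase its norm, and [|y| = |w|]. *)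
Lemma sigma_min_compression_norm2 n (A : 'M[C]_n) (X : 'M[C]_(n, n.-1)) x w :
  orthonormal_basis_orthogonal X x -> x ^t* *m w = 0 ->
  sigma_min (X ^t* *m A *m X) * norm2 w <= norm2 (A *m w).
Proof.
case=> XX Xsp xw.
have [y _ <-] : colspan X w by rewrite Xsp.
rewrite (orthonormal_cols_norm2 _ XX).
apply: le_trans (sigma_min_norm2 _ _) _.
by rewrite -!mulmxA; exact: orthonormal_cols_adj_norm2.
Qed.

Lemma colspan_orthoproj m n (W : 'M[C]_(n, m)) v :
  orthonormal_cols W -> colspan W v -> W *m W ^t* *m v = v.
Proof. by move=> WW [y _ <-]; rewrite -mulmxA (mulmxA _ W) WW mul1mx. Qed.

Lemma colspanD m n (W : 'M[C]_(n, m)) u v :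
  colspan W u -> colspan W v -> colspan W (u + v).
Proof. by move=> [y _ <-] [z _ <-]; exists (y + z); rewrite ?mulmxDr. Qed.

Lemma colspanZ m n (W : 'M[C]_(n, m)) k u :
  colspan W u -> colspan W (k *: u).
Proof. by move=> [y _ <-]; exists (k *: y); rewrite ?scalemxAr. Qed.

Lemma colspan_orthoproj_in m n (W : 'M[C]_(n, m)) x :
  colspan W (W *m W ^t* *m x).
Proof. by exists (W ^t* *m x); rewrite ?mulmxA. Qed.

Lemma refined_ritz_vector_norm2_le m n (A : 'M[C]_n) (W : 'M[C]_(n, m)) v u :
  refined_ritz_vector A W v -> colspan W u ->
  norm2 (A *m v) * norm2 u <= norm2 (A *m u).
Proof.
case=> _ _ opt Wu; have [->|u0] := eqVneq (norm2 u) 0.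
  by rewrite mulr0 norm2_ge0.
have up : 0 < norm2 u by rewrite lt_neqAle eq_sym u0 norm2_ge0.
have ui : cabs ((norm2 u)^-1)%:C%C = (norm2 u)^-1.
  by rewrite cabs_real gtr0_norm ?invr_gt0.
have := opt _ (colspanZ ((norm2 u)^-1)%:C%C Wu).
rewrite -scalemxAr !norm2Z ui mulVf // => /(_ erefl).
by rewrite mulrC ler_pdivlMr.
Qed.

(** For real [t], [|A (v + t u)|^2 - |A v|^2 |v + t u|^2] is nonnegative with zero constant term, so
    its linear coefficient vanishes. *)
Lemma refined_ritz_vector_stationary m n (A : 'M[C]_n) (W : 'M[C]_(n, m)) v u :
  refined_ritz_vector A W v -> colspan W u ->
  rdot (A *m v) (A *m u) = norm2 (A *m v) ^+ 2 * rdot v u.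
Proof.
move=> ref Wu; have [Wv v1 _] := ref; set tau := norm2 (A *m v).
apply/eqP; rewrite -subr_eq0; apply/eqP.
apply: (@linear_coef0 _ _ (norm2 (A *m u) ^+ 2 - tau ^+ 2 * norm2 u ^+ 2)) => t.
have := refined_ritz_vector_norm2_le ref (colspanD Wv (colspanZ t%:C%C Wu)).
rewrite -(@ler_pXn2r _ 2) ?nnegrE ?mulr_ge0 ?norm2_ge0 // exprMn -/tau.
rewrite mulmxDr -scalemxAr !norm2_sqrDZ v1 -/tau; lra.
Qed.

(** Sharper than Cauchy-Schwarz: the form [|A z|^2 - s^2 |z|^2] is nonnegative along [u + t w], and
    orthogonality removes its cross term in [s]. The gain [- s ^+ 2] is essential for the sine
    bound. *)
Lemma rdot_image_sqr_le n (A : 'M[C]_n) (s : R) u w :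
  (forall t : R, s * norm2 (u + t%:C%C *: w) <= norm2 (A *m (u + t%:C%C *: w))) ->
  0 <= s -> rdot u w = 0 ->
  rdot (A *m u) (A *m w) ^+ 2
    <= (opnorm2 A ^+ 2 - s ^+ 2) * norm2 u ^+ 2 * norm2 (A *m w) ^+ 2.
Proof.
move=> low s0 uw.
apply: le_trans (_ : (norm2 (A *m u) ^+ 2 - s ^+ 2 * norm2 u ^+ 2)
                       * norm2 (A *m w) ^+ 2 <= _).
  apply: discriminant_le; first exact: sqr_ge0.
  move=> t.
  have := low t; rewrite -(@ler_pXn2r _ 2) ?nnegrE ?mulr_ge0 ?norm2_ge0 //.
  rewrite exprMn mulmxDr -scalemxAr !norm2_sqrDZ uw.
  have : 0 <= s ^+ 2 * (t ^+ 2 * norm2 w ^+ 2).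
    by apply: mulr_ge0; rewrite ?sqr_ge0 //; apply: mulr_ge0; rewrite sqr_ge0.
  lra.
rewrite ler_wpM2r ?sqr_ge0 // mulrBl lerD2r -exprMn.
by rewrite lerXn2r ?nnegrE ?mulr_ge0 ?norm2_ge0 ?opnorm2_ge0 // norm2_mulmx_le.
Qed.

End RefinedRitzVector.

(** * The projection of the eigenvector onto the search space *)

Section SineBound.
Local Open Scope sesquilinear_scope.
Variables (R : realType) (n m : nat).
Local Notation C := R[i].
Implicit Types (A : 'M[C]_n) (W : 'M[C]_(n, m)) (x : 'cV[C]_n).

Lemma sin_angle_colspan_ge0 x W : 0 <= sin_angle_colspan x W.
Proof. exact: norm2_ge0. Qed.

Lemma rdot_orthoproj x W : orthonormal_cols W ->
  rdot x (W *m W ^t* *m x) = norm2 (W *m W ^t* *m x) ^+ 2.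
Proof.
move=> WW; rewrite -mulmxA (orthonormal_cols_norm2 _ WW) rdot_adj.
by rewrite norm2_sqr.
Qed.

Lemma orthoproj_norm2_sqr x W : orthonormal_cols W -> norm2 x = 1 ->
  norm2 (W *m W ^t* *m x) ^+ 2 = 1 - sin_angle_colspan x W ^+ 2.
Proof.
move=> WW x1; rewrite /sin_angle_colspan mulmxBl mul1mx.
set p := W *m W ^t* *m x.
rewrite norm2_sqrD norm2N rdotNr (rdot_orthoproj x WW) x1; ring.
Qed.

Lemma dotmx_orthoproj x W : orthonormal_cols W -> norm2 x = 1 ->
  (x ^t* *m (W *m W ^t* *m x)) 0 0 = (1 - sin_angle_colspan x W ^+ 2)%:C%C.
Proof.
move=> WW x1; rewrite -orthoproj_norm2_sqr // -mulmxA.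
rewrite (orthonormal_cols_norm2 _ WW) -dotmx_self.
by rewrite trmx_mul map_mxM trmxCK !mulmxA.
Qed.

(* The component of [P x] orthogonal to [x], up to sign *)
Definition orthoproj_defect x W : 'cV[C]_n :=
  (1 - sin_angle_colspan x W ^+ 2)%:C%C *: x - W *m W ^t* *m x.

Lemma dotmx_orthoproj_defect x W : orthonormal_cols W -> norm2 x = 1 ->
  x ^t* *m orthoproj_defect x W = 0.
Proof.
move=> WW x1; apply/matrixP => i j; rewrite !ord1 mulmxBr -scalemxAr.
have E k (u v : 'M[C]_1) : (k *: u - v) 0 0 = k * u 0 0 - v 0 0 by rewrite !mxE.
rewrite E dotmx_self dotmx_orthoproj // x1 expr1n mulr1 subrr.
by rewrite !mxE.
Qed.

Lemma norm2_orthoproj_defect x W : orthonormal_cols W -> norm2 x = 1 ->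
  norm2 (orthoproj_defect x W) ^+ 2
  = (1 - sin_angle_colspan x W ^+ 2) * sin_angle_colspan x W ^+ 2.
Proof.
have collect (p : R) :
    (1 - p) + 2 * (1 - p) * - (1 - p) + (1 - p) ^+ 2 * 1 ^+ 2 = (1 - p) * p.
  by ring.
move=> WW x1; move: (orthoproj_norm2_sqr WW x1); rewrite /orthoproj_defect.
move: (sin_angle_colspan x W) => s pn.
rewrite addrC norm2_sqrDZ norm2N x1 rdotNl.
rewrite (rdotC _ x) (rdot_orthoproj x WW) pn.
exact: collect.
Qed.

(** Split [P x = c^2 x - F] with [F] orthogonal to [x] and [|F| = c s]. *)
Lemma norm2_mul_orthoproj_le A x W : orthonormal_cols W -> norm2 x = 1 ->
  let s := sin_angle_colspan x W in let c := Num.sqrt (1 - s ^+ 2) in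
  s < 1 ->
  norm2 (A *m (W *m W ^t* *m x))
    <= c * (c * norm2 (A *m x) + opnorm2 A * s).
Proof.
move=> WW x1 s c s1; have s0 : 0 <= s := sin_angle_colspan_ge0 x W.
have c2 : c ^+ 2 = 1 - s ^+ 2.
  by rewrite sqr_sqrtr // subr_ge0 expr_le1 // ltW.
have Fn : norm2 (orthoproj_defect x W) = c * s.
  apply/eqP; rewrite -(@eqrXn2 _ 2) ?norm2_ge0 ?mulr_ge0 ?sqrtr_ge0 //.
  by rewrite norm2_orthoproj_defect // exprMn c2.
have -> : W *m W ^t* *m x = (c ^+ 2)%:C%C *: x - orthoproj_defect x W.
  by rewrite /orthoproj_defect -/s c2 opprB addrC subrK.
rewrite mulmxBr -scalemxAr; apply: le_trans (norm2D _ _) _.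
rewrite norm2N norm2Z cabs_real ger0_norm ?sqr_ge0 //.
have := norm2_mulmx_le A (orthoproj_defect x W); rewrite Fn; lra.
Qed.

End SineBound.

(** * Residual bound and squared sine bound *)

Section SineBoundRitz.
Local Open Scope sesquilinear_scope.
Variables (R : realType) (n m : nat).
Local Notation C := R[i].

(** Compare with [P x], whose norm is [c]. There is no division by [c] here: the sine bound needs
    the residual to be at most [|A x| + |A| s]. *)
Lemma refined_ritz_vector_residual_le (A : 'M[C]_n) (W : 'M[C]_(n, m)) x v :
  orthonormal_cols W -> norm2 x = 1 -> refined_ritz_vector A W v ->
  let s := sin_angle_colspan x W in let c := Num.sqrt (1 - s ^+ 2) in
  s < 1 ->
  norm2 (A *m v) <= c * norm2 (A *m x) + opnorm2 A * s.
Proof.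
move=> WW x1 ref s c s1; have s0 : 0 <= s := sin_angle_colspan_ge0 x W.
have c2 : 0 < 1 - s ^+ 2 by rewrite subr_gt0 expr_lt1.
have cp : 0 < c by rewrite sqrtr_gt0.
have := refined_ritz_vector_norm2_le ref (colspan_orthoproj_in W x).
have -> : norm2 (W *m W ^t* *m x) = c.
  by rewrite /c -orthoproj_norm2_sqr // sqrtr_sqr ger0_norm ?norm2_ge0.
move=> /le_trans/(_ (norm2_mul_orthoproj_le A WW x1 s1)).
by rewrite -/s -/c mulrC ler_pM2l.
Qed.

Lemma refined_ritz_vector_sine_sqr_le (A : 'M[C]_n) (W : 'M[C]_(n, m))
    (X : 'M[C]_(n, n.-1)) x v :
  orthonormal_basis_orthogonal X x -> norm2 x = 1 -> orthonormal_cols W ->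
  refined_ritz_vector A W v ->
  let s := sin_angle_colspan x W in
  let sigma := sigma_min (X ^t* *m A *m X) in
  s < 1 -> 0 < sigma -> sigma <= opnorm2 A ->
  (1 - cabs ((x ^t* *m v) 0 0) ^+ 2) * (1 - s ^+ 2)
    <= (norm2 (A *m x) + opnorm2 A * s) ^+ 2 / sigma ^+ 2.
Proof.
have cross_eq (k c d a s r : R) :
    c ^+ 2 * (k * a * d) + r * (k * c * s) * d = k * c * d * (c * a + s * r).
  by ring.
have square_eq (p q t : R) :
  (p + q * t) ^+ 2 = p ^+ 2 + 2 * (p * (q * t)) + q ^+ 2 * t ^+ 2 by ring.
have square_le (p q a M s t : R) : p <= a ^+ 2 -> q <= a * (s * M) ->
    p + 2 * q + s ^+ 2 * (M ^+ 2 - t ^+ 2) <= (a + M * s) ^+ 2 - t ^+ 2 * s ^+ 2.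
  by lra.
have sine_eq (S Y : R) : 1 - Y * (1 - S) = S + (1 - S) * (1 - Y) by ring.
move=> Xx x1 WW ref s sigma s1 sigma_gt0 sigmaM.
have [Wv v1 _] := ref.
set a := norm2 (A *m x); set M := opnorm2 A in sigmaM *.
set tau := norm2 (A *m v); set alpha := (x ^t* *m v) 0 0.
have s0 : 0 <= s := sin_angle_colspan_ge0 x W.
have a0 : 0 <= a by exact: norm2_ge0.
have M0 : 0 <= M by exact: opnorm2_ge0.
pose c := Num.sqrt (1 - s ^+ 2).
have cc_gt0 : 0 < 1 - s ^+ 2 by rewrite subr_gt0 expr_lt1.
have cc : c ^+ 2 = 1 - s ^+ 2 by rewrite sqr_sqrtr // ltW.
have c0 : 0 <= c by exact: sqrtr_ge0.
have c1 : c <= 1 by rewrite -(@expr_le1 _ 2) // cc lerBlDr lerDl sqr_ge0.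
have tau_le : tau <= c * a + M * s.
  exact: refined_ritz_vector_residual_le WW x1 ref s1.
pose y := W *m W ^t* *m x; pose F := orthoproj_defect x W.
(* Since [x^H y = 1 - s^2], this coefficient makes [w = v - k y] orthogonal to [x]. *)
pose k := alpha / (1 - s ^+ 2)%:C%C.
pose Y := k *: y; pose w := v - Y.
have kc : k * (1 - s ^+ 2)%:C%C = alpha.
  by rewrite /k divfK // -(rmorph0 (real_complex R)) (inj_eq (@complexI R)) gt_eqF.
have E h (u u' : 'M[C]_1) : (u - h *: u') 0 0 = u 0 0 - h * u' 0 0.
  by rewrite !mxE.
have xw : x ^t* *m w = 0.
  apply/matrixP => i j; rewrite !ord1 mulmxBr -scalemxAr E dotmx_orthoproj //.
  by rewrite -/s kc -/alpha subrr mxE.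
(* As [v] lies in the search space, [x] may be replaced by its projection [y]; thus [w] is
   orthogonal to [y] too. *)
have yv : y ^t* *m v = x ^t* *m v.
  rewrite -{2}(colspan_orthoproj WW Wv) /y !trmx_mul !map_mxM trmxCK.
  by rewrite !mulmxA.
have yy : (y ^t* *m y) 0 0 = (1 - s ^+ 2)%:C%C.
  by rewrite /y dotmx_self; congr (_%:C%C); exact: orthoproj_norm2_sqr.
have yw : y ^t* *m w = 0.
  apply/matrixP => i j; rewrite !ord1 mulmxBr -scalemxAr E yy yv.
  by rewrite kc -/alpha subrr mxE.
have rdotZ0 h (u u' : 'cV[C]_n) : u ^t* *m u' = 0 -> rdot (h *: u) u' = 0.
  by move=> u0; rewrite /rdot linearZ /= map_mxZ -scalemxAl u0 scaler0 mxE.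
have ortho_sym (u u' : 'cV[C]_n) : u ^t* *m u' = 0 -> u' ^t* *m u = 0.
  by move=> /(congr1 (fun B => B ^t* )); rewrite trmx_mul map_mxM trmxCK trmx0 map_mx0.
have Yw : rdot Y w = 0 by exact: rdotZ0.
have vE : v = Y + w by rewrite /w addrC subrK.
have XY : norm2 Y ^+ 2 + norm2 w ^+ 2 = 1.
  by have := norm2_sqrD Y w; rewrite -vE v1 Yw expr1n mulr0 addr0 => <-.
have kX : cabs k ^+ 2 * c ^+ 2 = norm2 Y ^+ 2.
  by rewrite /Y norm2Z exprMn orthoproj_norm2_sqr // cc.
have alphaX : cabs alpha ^+ 2 = norm2 Y ^+ 2 * (1 - s ^+ 2).
  rewrite -kX -kc /cabs Normc.normcM -!/(cabs _) cabs_real gtr0_norm // -cc.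
  ring.
have WY : colspan W Y by apply: colspanZ; exact: colspan_orthoproj_in.
have Ww : colspan W w.
  by rewrite /w -scaleN1r; apply: colspanD => //; exact: colspanZ.
pose d := A *m w; pose g := A *m Y; pose h := rdot g d.
have AvE : A *m v = g + d by rewrite vE mulmxDr.
(* Stationarity in the direction [w], and next in the direction [Y]. *)
have e1 : norm2 d ^+ 2 + h = tau ^+ 2 * norm2 w ^+ 2.
  have := refined_ritz_vector_stationary ref Ww.
  rewrite -/tau AvE vE (rdotDl Y w) (rdotDl g d) Yw add0r -!norm2_sqr => <-.
  by rewrite addrC.
have e2 : norm2 g ^+ 2 + h = tau ^+ 2 * norm2 Y ^+ 2.
  have := refined_ritz_vector_stationary ref WY.
  rewrite -/tau AvE vE (rdotDl Y w) (rdotDl g d) (rdotC w) Yw addr0 -!norm2_sqr.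
  by rewrite (rdotC d).
have low_perp u : x ^t* *m u = 0 -> sigma * norm2 u <= norm2 (A *m u).
  exact: sigma_min_compression_norm2.
have d_low : sigma ^+ 2 * norm2 w ^+ 2 <= norm2 d ^+ 2.
  rewrite -exprMn lerXn2r ?nnegrE ?mulr_ge0 ?norm2_ge0 ?(ltW sigma_gt0) //.
  exact: low_perp.
have N0 : 0 <= c * a + M * s by rewrite addr_ge0 ?mulr_ge0.
have N_le : c * a + M * s <= a + M * s by rewrite lerD2r ler_piMl.
have g_le : norm2 g ^+ 2 <= norm2 Y ^+ 2 * (a + M * s) ^+ 2.
  rewrite -kX -!exprMn lerXn2r ?nnegrE ?norm2_ge0 //.
    by rewrite !mulr_ge0 ?cabs_ge0 // (le_trans N0).
  rewrite /g -scalemxAr norm2Z -mulrA ler_wpM2l ?cabs_ge0 //.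
  apply: le_trans (norm2_mul_orthoproj_le A WW x1 s1) _.
  by rewrite -/s -/c -/a -/M ler_wpM2l.
pose r := Num.sqrt (M ^+ 2 - sigma ^+ 2).
have rr : r ^+ 2 = M ^+ 2 - sigma ^+ 2.
  by rewrite sqr_sqrtr // subr_ge0 lerXn2r ?nnegrE // ltW.
have r0 : 0 <= r by exact: sqrtr_ge0.
have rM : r <= M.
  by rewrite -(@ler_pXn2r _ 2) ?nnegrE // rr lerBlDr lerDl sqr_ge0.
(* The [x] part of the cross term is handled by Cauchy-Schwarz; the [F] part is orthogonal to both
   [x] and [w], so it gets the factor [r] instead of [M]. *)
have gE : g = (c ^+ 2)%:C%C *: (A *m (k *: x)) - A *m (k *: F).
  rewrite /g /Y (scalemxAr (c ^+ 2)%:C%C A) -mulmxBr; congr (_ *m _).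
  have -> : (c ^+ 2)%:C%C *: (k *: x) = k *: ((c ^+ 2)%:C%C *: x).
    by rewrite !scalerA mulrC.
  rewrite -scalerBr; congr (_ *: _).
  by rewrite /F /orthoproj_defect -/s -cc opprB addrC subrK.
have norm_rdot_le (u u' : 'cV[C]_n) : `|rdot u u'| <= norm2 u * norm2 u'.
  by rewrite ler_norml rdot_le andbT lerNl -rdotNl -(norm2N u) rdot_le.
have h_le : `|h| <= cabs k * c * norm2 d * (c * a + s * r).
  rewrite /h gE rdotDl rdotNl rdotZl; apply: le_trans (ler_normB _ _) _.
  have b1 : `|rdot (A *m (k *: x)) d| <= cabs k * a * norm2 d.
    by apply: le_trans (norm_rdot_le _ _) _; rewrite -scalemxAr norm2Z.
  have kF_low (t : R) : sigma * norm2 (k *: F + t%:C%C *: w)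
      <= norm2 (A *m (k *: F + t%:C%C *: w)).
    apply: low_perp; rewrite mulmxDr -!scalemxAr xw.
    by rewrite dotmx_orthoproj_defect // !scaler0 addr0.
  have Fw : rdot (k *: F) w = 0.
    apply/rdotZ0/ortho_sym.
    rewrite /F /orthoproj_defect -/y mulmxBr -scalemxAr.
    by rewrite (ortho_sym _ _ xw) (ortho_sym _ _ yw) scaler0 subrr.
  have b2 : `|rdot (A *m (k *: F)) d| <= r * (cabs k * c * s) * norm2 d.
    rewrite -(@ler_pXn2r _ 2) ?nnegrE ?mulr_ge0 ?cabs_ge0 ?norm2_ge0 //.
    rewrite real_normK ?num_real //.
    apply: le_trans (rdot_image_sqr_le kF_low (ltW sigma_gt0) Fw) _.
    rewrite -/M -rr norm2Z exprMn norm2_orthoproj_defect // -/s -cc -!exprMn.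
    by rewrite !mulrA.
  rewrite normrM (ger0_norm (sqr_ge0 c)).
  apply: le_trans (lerD (ler_wpM2l (sqr_ge0 c) b1) b2) _.
  by rewrite cross_eq.
(* In the square, [r ^+ 2] is kept exactly, which leaves [- sigma ^+ 2 * s ^+ 2]; after scaling this
   is the [q - S] of the scalar lemma. Elsewhere [c <= 1] and [r <= M] suffice. *)
have h_sqr : h ^+ 2 <= norm2 Y ^+ 2 * norm2 d ^+ 2
    * ((a + M * s) ^+ 2 - sigma ^+ 2 * s ^+ 2).
  have hp : 0 <= cabs k * c * norm2 d * (c * a + s * r).
    by rewrite !mulr_ge0 ?cabs_ge0 ?norm2_ge0 // addr_ge0 ?mulr_ge0.
  have := h_le; rewrite -(@ler_pXn2r _ 2) ?nnegrE // real_normK ?num_real //.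
  move=> /le_trans; apply; rewrite !exprMn kX.
  apply: ler_wpM2l; first by apply: mulr_ge0; exact: sqr_ge0.
  have i1 : (c * a) ^+ 2 <= a ^+ 2.
    by rewrite lerXn2r ?nnegrE ?mulr_ge0 // ler_piMl.
  have i2 : (c * a) * (s * r) <= a * (s * M).
    by rewrite ler_pM ?mulr_ge0 // ?ler_piMl // ler_wpM2l.
  by rewrite [leLHS]square_eq rr; exact: square_le.
have s2_gt0 : 0 < sigma ^+ 2 by rewrite exprn_gt0.
have div e u : e / sigma ^+ 2 <= u / sigma ^+ 2 = (e <= u).
  by rewrite ler_pM2r // invr_gt0.
have -> : 1 - cabs alpha ^+ 2 = s ^+ 2 + (1 - s ^+ 2) * norm2 w ^+ 2.
  have -> : norm2 w ^+ 2 = 1 - norm2 Y ^+ 2.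
    by apply/eqP; rewrite eq_sym subr_eq addrC XY.
  by rewrite alphaX; exact: sine_eq.
(* Everything is scaled by [sigma ^+ 2], and the cross term enters with its sign reversed. *)
apply: (@ritz_sine_ineq _ (s ^+ 2) (norm2 Y ^+ 2) (norm2 w ^+ 2) _
  (norm2 d ^+ 2 / sigma ^+ 2) (norm2 g ^+ 2 / sigma ^+ 2)
  (- h / sigma ^+ 2) (tau ^+ 2 / sigma ^+ 2)); rewrite ?sqr_ge0 //.
- by rewrite -subr_gt0.
- rewrite ler_pdivlMr // -exprMn lerXn2r ?nnegrE ?mulr_ge0 ?(ltW sigma_gt0) //.
    exact: le_trans N0 N_le.
  by rewrite mulrC; apply: le_trans (ler_wpM2r s0 sigmaM) _; rewrite lerDr.
- by rewrite ler_pdivlMr // mulrC.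
- by apply: divr_ge0; exact: sqr_ge0.
- by rewrite mulrA div.
- have -> : (- h / sigma ^+ 2) ^+ 2 = h ^+ 2 / sigma ^+ 2 / sigma ^+ 2.
    by rewrite expr_div_n sqrrN -mulrA -invfM -expr2.
  have -> : norm2 Y ^+ 2 * (norm2 d ^+ 2 / sigma ^+ 2)
      * ((a + M * s) ^+ 2 / sigma ^+ 2 - s ^+ 2)
    = norm2 Y ^+ 2 * norm2 d ^+ 2 * ((a + M * s) ^+ 2 - sigma ^+ 2 * s ^+ 2)
      / sigma ^+ 2 / sigma ^+ 2 by field; rewrite gt_eqF.
  by rewrite !div.
- by rewrite mulNr opprK -mulrDl e1 mulrAC.
- by rewrite mulNr opprK -mulrDl e2 mulrAC.
- rewrite div lerXn2r ?nnegrE ?norm2_ge0 //; last exact: le_trans tau_le N_le.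
  exact: le_trans N0 N_le.
Qed.

End SineBoundRitz.

(** * From the squared bound to the sine of the angle *)

Section RitzVectorAngle.
Local Open Scope sesquilinear_scope.
Variables (R : realType) (n : nat).
Local Notation C := R[i].

Lemma sigma_min_gt0_dim p (A : 'M[C]_p) : 0 < sigma_min A -> (0 < p)%N.
Proof.
case: p A => // A; rewrite /sigma_min (_ : singular_values A = set0) ?inf0 ?ltxx //.
rewrite -subset0 => s [_ /eigenvalueP[w _]].
by rewrite (thinmx0 w) eqxx.
Qed.

(** Test both bounds on one nonzero vector of the column span of [X]; positivity of [sigma_min]
    ensures that [X] has a column. *)
Lemma sigma_min_compression_le_opnorm2 (A : 'M[C]_n) (X : 'M[C]_(n, n.-1)) x :
  orthonormal_basis_orthogonal X x ->
  0 < sigma_min (X ^t* *m A *m X) -> sigma_min (X ^t* *m A *m X) <= opnorm2 A.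
Proof.
move=> Xx s_gt0; have n_gt0 := sigma_min_gt0_dim s_gt0.
have [XX Xsp] := Xx.
pose e : 'cV[C]_n.-1 := delta_mx (Ordinal n_gt0) 0.
have e_gt0 : 0 < norm2 e.
  rewrite lt_neqAle norm2_ge0 andbT eq_sym; apply/eqP => /norm2_eq0 /matrixP.
  by move=> /(_ (Ordinal n_gt0) 0)/eqP; rewrite !mxE !eqxx oner_eq0.
rewrite -(ler_pM2r e_gt0) -(orthonormal_cols_norm2 e XX).
apply: le_trans (norm2_mulmx_le _ _).
apply: sigma_min_compression_norm2 Xx _.
suff : colspan X (X *m e) by rewrite Xsp.
by exists e.
Qed.

Lemma sin_line_angle x (v : 'cV[C]_n) : norm2 x = 1 -> norm2 v = 1 ->
  sin (line_angle x v) = Num.sqrt (1 - cabs ((x ^t* *m v) 0 0) ^+ 2).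
Proof.
move=> x1 v1; rewrite /line_angle x1 v1 mulr1 divr1 sin_acos //.
(* The unit vector [x] is a matrix with one orthonormal column, which puts the cosine in the domain
   where [sin_acos] applies. *)
have xx : orthonormal_cols x.
  apply/matrixP => i j; rewrite !ord1 dotmx_self x1 expr1n mxE eqxx.
  by rewrite rmorph1.
rewrite (le_trans _ (cabs_ge0 _)) ?lerN10 //= -v1.
by apply: le_trans (orthonormal_cols_adj_norm2 v xx); exact: cabs_le_norm2.
Qed.

Lemma refined_ritz_vector_sine_le m (A : 'M[C]_n) (W : 'M[C]_(n, m))
    (X : 'M[C]_(n, n.-1)) x v :
  orthonormal_basis_orthogonal X x -> norm2 x = 1 -> orthonormal_cols W ->
  refined_ritz_vector A W v ->
  let s := sin_angle_colspan x W in
  let sigma := sigma_min (X ^t* *m A *m X) in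
  s < 1 -> 0 < sigma ->
  sin (line_angle x v)
    <= (norm2 (A *m x) + opnorm2 A * s) / (Num.sqrt (1 - s ^+ 2) * sigma).
Proof.
move=> Xx x1 WW ref s sigma s1 sigma_gt0.
have [_ v1 _] := ref; rewrite sin_line_angle //.
have s0 : 0 <= s := sin_angle_colspan_ge0 x W.
have cc_gt0 : 0 < 1 - s ^+ 2 by rewrite subr_gt0 expr_lt1.
have bound := refined_ritz_vector_sine_sqr_le Xx x1 WW ref s1 sigma_gt0
  (sigma_min_compression_le_opnorm2 Xx sigma_gt0).
have N0 : 0 <= norm2 (A *m x) + opnorm2 A * s.
  by rewrite addr_ge0 ?norm2_ge0 // mulr_ge0 // opnorm2_ge0.
have D0 : 0 < Num.sqrt (1 - s ^+ 2) * sigma by rewrite mulr_gt0 ?sqrtr_gt0.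
rewrite -[leRHS]ger0_norm ?divr_ge0 ?(ltW D0) // -sqrtr_sqr.
apply: ler_wsqrtr; rewrite expr_div_n exprMn sqr_sqrtr ?(ltW cc_gt0) //.
have s2_gt0 : 0 < sigma ^+ 2 by rewrite exprn_gt0.
by rewrite ler_pdivlMr ?mulr_gt0 // mulrA -ler_pdivlMr.
Qed.

End RitzVectorAngle.

(** * Perturbation of [sigma_min] from [lam] to [mu], and assembly of the estimates *)

Theorem theorem4p1 (R : realType) (n m : nat)
    (Omega : set R[i]) (T : R[i] -> 'M[R[i]]_n)
    (lam : R[i]) (x : 'cV[R[i]]_n) (Xperp : 'M[R[i]]_(n, n.-1))
    (W : 'M[R[i]]_(n, m)) (mu : R[i]) (xhat : 'cV[R[i]]_n) (eta r : R) :
  let L := compression Xperp T in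
  let B := compression W T in
  let D := cdisc lam r in
  let eps := sin_angle_colspan x W in
  let delta := cabs (mu - lam) in
  let beta := opnorm2 (derive1n 2 L lam) / 2 + eta in
  let gamma := opnorm2 (derive1n 2 T lam) / 2 + eta in
  connected_open Omega ->
  analytic_on Omega T ->
  (exists2 z, Omega z & \det (T z) != 0) ->
  Omega lam ->
  simple_eigenpair T lam x ->
  orthonormal_basis_orthogonal Xperp x ->
  orthonormal_cols W ->
  eps < 1 ->
  Omega mu ->
  \det (B mu) = 0 ->
  refined_ritz_vector (T mu) W xhat ->
  0 < eta ->
  0 < r ->
  D `<=` Omega ->
  taylor_cvg_on T lam D ->
  taylor_cvg_on L lam D ->
  (forall z, D z -> opnorm2 (taylor_rem2 T lam z) <= eta) ->
  (forall z, D z -> opnorm2 (taylor_rem2 L lam z) <= eta) ->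
  D mu ->
  0 < sigma_min (L lam) - opnorm2 (derive1 L lam) * delta - beta * delta ^+ 2 ->
  [/\ norm2 (T mu *m xhat)
        <= (norm2 (T mu *m x) + opnorm2 (T mu) * eps) / Num.sqrt (1 - eps ^+ 2),
      (norm2 (T mu *m x) + opnorm2 (T mu) * eps) / Num.sqrt (1 - eps ^+ 2)
        <= (opnorm2 (T mu) * eps + opnorm2 (derive1 T lam) * delta
              + gamma * delta ^+ 2) / Num.sqrt (1 - eps ^+ 2),
      sin (line_angle x xhat)
        <= (norm2 (T mu *m x) + opnorm2 (T mu) * eps)
             / (Num.sqrt (1 - eps ^+ 2) * sigma_min (L mu)),
      (norm2 (T mu *m x) + opnorm2 (T mu) * eps)
             / (Num.sqrt (1 - eps ^+ 2) * sigma_min (L mu))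
        <= (opnorm2 (T mu) * eps + opnorm2 (derive1 T lam) * delta
              + gamma * delta ^+ 2)
             / (Num.sqrt (1 - eps ^+ 2) * sigma_min (L mu)) &
      sigma_min (L lam) - opnorm2 (derive1 L lam) * delta - beta * delta ^+ 2
        <= sigma_min (L mu)].
Proof.
move=> L B D eps delta beta gamma _ _ _ _ [_ Tx x1] Xx WW eps1 _ _ ref eta0 _ _.
move=> TD LD remT remL Dmu gap.
have delta0 : 0 <= delta by exact: cabs_ge0.
have eps0 : 0 <= eps by exact: sin_angle_colspan_ge0.
have low : sigma_min (L lam) - opnorm2 (derive1 L lam) * delta
    - beta * delta ^+ 2 <= sigma_min (L mu).
  (* Positivity is needed to know that [n.-1] is positive, as [le_sigma_min] requires. *)
  have L0 : 0 < sigma_min (L lam).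
    have : 0 <= opnorm2 (derive1 L lam) * delta by rewrite mulr_ge0 ?opnorm2_ge0.
    have : 0 <= beta * delta ^+ 2.
      apply: mulr_ge0; last exact: sqr_ge0.
      by rewrite addr_ge0 ?(ltW eta0) // divr_ge0 ?opnorm2_ge0.
    move=> q0 p0; apply: lt_le_trans gap _.
    by rewrite -addrA -opprD lerBlDr lerDl addr_ge0.
  apply: (le_sigma_min (sigma_min_gt0_dim L0)) => v.
  rewrite -addrA -opprD mulrBl lerBlDr.
  apply: le_trans (sigma_min_norm2 (L lam) v) _.
  (* Triangle inequality for [L lam v = L mu v - (L mu - L lam) v]. *)
  have := norm2D (L mu *m v) (- ((L mu - L lam) *m v)).
  rewrite norm2N {1}mulmxBl opprB [X in norm2 X](addrC (L mu *m v)) subrK.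
  move=> /le_trans; apply; rewrite lerD2l.
  exact: norm2_taylor_le v LD Dmu (remL _ Dmu).
have s_gt0 : 0 < sigma_min (L mu) := lt_le_trans gap low.
have c_gt0 : 0 < Num.sqrt (1 - eps ^+ 2).
  by rewrite sqrtr_gt0 subr_gt0 expr_lt1.
have num_le : norm2 (T mu *m x) + opnorm2 (T mu) * eps
    <= opnorm2 (T mu) * eps + opnorm2 (derive1 T lam) * delta
       + gamma * delta ^+ 2.
  (* Because [T lam *m x = 0], the Taylor increment applied to [x] is [T mu *m x] itself. *)
  have := norm2_taylor_le x TD Dmu (remT _ Dmu).
  rewrite mulmxBl Tx subr0 x1 mulr1 -/delta -/gamma => Tx_le.
  by rewrite [leLHS]addrC -[leRHS]addrA lerD2l.
split.
(* With [c = Num.sqrt (1 - eps ^+ 2)], the residual bound times [c] stays below the numerator since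
   [c <= 1]. *)
- apply: le_trans (refined_ritz_vector_residual_le WW x1 ref eps1) _.
  rewrite -/eps ler_pdivlMr // mulrC mulrDr mulrA; apply: lerD.
    rewrite -expr2 sqr_sqrtr; last by rewrite subr_ge0 expr_le1 // ltW.
    by rewrite ler_piMl ?norm2_ge0 // lerBlDr lerDl sqr_ge0.
  rewrite ler_piMl ?mulr_ge0 ?opnorm2_ge0 //.
  rewrite -[leRHS]sqrtr1 ler_wsqrtr // lerBlDr lerDl; exact: sqr_ge0.
- by rewrite ler_pM2r // invr_gt0.
- exact: refined_ritz_vector_sine_le Xx x1 WW ref eps1 s_gt0.
- by rewrite ler_pM2r // invr_gt0 mulr_gt0.
- exact: low.
Qed.
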